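(* Let $(M,g)$ and $(N,h)$ be compact smooth Riemannian manifolds without boundary, of dimensions $n$ and $k$ respectively, let $f:M\to(0,\infty)$ be a smooth function, and let $\pi_M:M\times_{f^2}N\to M$ be the projection. Let $p>2$ and $\varepsilon>0$. Then a positive $\mathcal{C}^2$-function $u:M\to\mathbb{R}$ solves $$-\varepsilon^2\,\mathrm{div}_g\left(f^k(x)\nabla_g u\right)+f^k(x)u=f^k(x)u^{p-1}\qquad\text{on }M$$ if and only if $v:=u\circ\pi_M:M\times_{f^2}N\to\mathbb{R}$ solves $$-\varepsilon^2\Delta_{\mathfrak{g}}v+v=v^{p-1}\qquad\text{on }M\times_{f^2}N.$$
   Context: The warped product $M\times_{f^2}N$ is the cartesian product $M\times N$ equipped with the Riemannian metric $\mathfrak{g}=g+f^2h$. $\Delta_{\mathfrak{g}}$ is its Laplace-Beltrami operator. *)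

(* Defs.v *)
From HB Require Import structures.
From mathcomp Require Import all_boot all_order all_algebra.
From mathcomp Require Import all_classical all_reals all_analysis.

Set Implicit Arguments.
Unset Strict Implicit.
Unset Printing Implicit Defensive.
Import Order.TTheory GRing.Theory Num.Theory.
Import numFieldNormedType.Exports.
Local Open Scope classical_set_scope.
Local Open Scope ring_scope.

Definition partial (R : realType) (n : nat) (i : 'I_n) (F : 'rV[R]_n -> R) :
    'rV[R]_n -> R :=
  fun x => 'D_('e_i) F x.

(* Meant for an open U, where the values of F outside U do not matter. *)
Fixpoint C_on (R : realType) (n r : nat) (U : set 'rV[R]_n)
    (F : 'rV[R]_n -> R) : Prop :=
  (forall x, U x -> {for x, continuous F}) /\
  if r is r'.+1 then
    forall i : 'I_n, (forall x, U x -> derivable F x 'e_i) /\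
              C_on r' U (partial i F)
  else True.

Definition smooth_on (R : realType) (n : nat) (U : set 'rV[R]_n)
    (F : 'rV[R]_n -> R) : Prop :=
  forall r, C_on r U F.

Section calculus.
Context {R : realType}.

Lemma C_on_cont n r (U : set 'rV[R]_n) F : C_on r U F ->
  forall x, U x -> {for x, continuous F}.
Proof. by case: r => [|r] []. Qed.

Lemma C_onS n r (U : set 'rV[R]_n) F : C_on r.+1 U F -> C_on r U F.
Proof.
elim: r F => [|r IH] F; first by move=> [].
move=> [cF dF]; split=> // i; have [h1 h2] := dF i; split=> //; exact: IH.
Qed.

Lemma eq_on_near n (U : set 'rV[R]_n) (F G : 'rV[R]_n -> R) x :
  open U -> (forall x, U x -> F x = G x) -> U x -> \near x, F x = G x.
Proof.
move=> oU FG Ux.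
by apply: filterS (open_nbhs_nbhs (conj oU Ux)) => y Uy; exact: FG.
Qed.

Lemma eq_C_on n r (U : set 'rV[R]_n) (F G : 'rV[R]_n -> R) : open U ->
  (forall x, U x -> F x = G x) -> C_on r U F -> C_on r U G.
Proof.
move=> oU; have cont (F' G' : 'rV[R]_n -> R) : (forall x, U x -> F' x = G' x) ->
    (forall x, U x -> {for x, continuous F'}) ->
    (forall x, U x -> {for x, continuous G'}).
  move=> FG cF x Ux; have h : F' @ x --> F' x := cF x Ux.
  suff : G' @ x --> G' x by [].
  rewrite -(FG _ Ux); apply: cvg_trans h.
  apply: near_eq_cvg; first exact: nbhs_filter.
  by apply: filterS (eq_on_near oU FG Ux) => y ->.
elim: r F G => [|r IH] F G FG; first by move=> [cF _]; split=> //; exact: cont cF.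
move=> [cF dF]; split; first exact: cont cF.
move=> i; have [h1 h2] := dF i; split.
  move=> x Ux; apply: near_eq_derivable (h1 _ Ux).
  exact: (eq_on_near oU FG Ux).
apply: IH h2 => x Ux; apply: near_eq_derive.
exact: (eq_on_near oU FG Ux).
Qed.

Lemma C_on_cst n r (U : set 'rV[R]_n) (c : R) : C_on r U (cst c).
Proof.
elim: r c => [|r IH] c; (split; first by move=> x _; exact: cst_continuous) => //.
move=> i; split; first by move=> x _; exact: derivable_cst.
rewrite (_ : partial i (cst c) = cst 0); first exact: IH.
by apply/funext => x; rewrite /partial derive_cst.
Qed.

Lemma C_onD n r (U : set 'rV[R]_n) F G : open U ->
  C_on r U F -> C_on r U G -> C_on r U (F \+ G).
Proof.
move=> oU; elim: r F G => [|r IH] F G [cF dF] [cG dG].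
  by split=> // x Ux; apply: continuousD; [exact: cF|exact: cG].
split=> [x Ux|i]; first by apply: continuousD; [exact: cF|exact: cG].
have [h1 h2] := dF i; have [k1 k2] := dG i; split.
  by move=> x Ux; apply: derivableD; [exact: h1|exact: k1].
apply: (@eq_C_on _ _ _ (partial i F \+ partial i G)) (IH _ _ h2 k2) => // x Ux.
by rewrite /partial/= -deriveD//; [exact: h1|exact: k1].
Qed.

Lemma C_onM n r (U : set 'rV[R]_n) F G : open U ->
  C_on r U F -> C_on r U G -> C_on r U (F \* G).
Proof.
move=> oU; elim: r F G => [|r IH] F G hF hG.
  case: hF hG => cF _ [cG _].
  by split=> // x Ux; apply: continuousM; [exact: cF|exact: cG].
have hF' := C_onS hF; have hG' := C_onS hG.
case: hF hG => cF dF [cG dG].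
split=> [x Ux|i]; first by apply: continuousM; [exact: cF|exact: cG].
have [h1 h2] := dF i; have [k1 k2] := dG i; split.
  by move=> x Ux; apply: derivableM; [exact: h1|exact: k1].
apply: (@eq_C_on _ _ _ ((F \* partial i G) \+ (G \* partial i F))) => //.
  move=> x Ux; rewrite /partial/= (_ : F \* G = F * G)//.
  by rewrite deriveM//; [exact: h1|exact: k1].
by apply: C_onD => //; apply: IH.
Qed.

Lemma derive_lin (V W : normedModType R) (L : {linear V -> W}) (F : W -> R)
  (x v : V) : 'D_v (F \o L) x = 'D_(L v) F (L x).
Proof.
rewrite /derive; set A := (X in lim (X @ _) = _); set B := (X in _ = lim (X @ _)).
suff -> : A = B by [].
by apply/funext => h; rewrite /A /B /= (linearD L) (linearZ_LR L).
Qed.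

Lemma derivable_lin (V W : normedModType R) (L : {linear V -> W}) (F : W -> R)
  (x v : V) : derivable F (L x) (L v) -> derivable (F \o L) x v.
Proof.
rewrite /derivable; set A := (X in cvg (X @ _) -> _).
set B := (X in _ -> cvg (X @ _)); suff -> : A = B by [].
by apply/funext => h; rewrite /A /B /= (linearD L) (linearZ_LR L).
Qed.

Lemma delta_lshift n k (i : 'I_n) :
  delta_mx 0 (lshift k i) = row_mx (delta_mx 0 i) 0 :> 'rV[R]_(n + k).
Proof.
apply/rowP => j; rewrite !mxE eqxx -[j == _]val_eqE /=.
case: splitP => j' ->; rewrite mxE ?eqxx -?val_eqE //=.
by rewrite gtn_eqF// (leq_trans (ltn_ord i)) ?leq_addr.
Qed.

Lemma delta_rshift n k (i : 'I_k) :
  delta_mx 0 (rshift n i) = row_mx 0 (delta_mx 0 i) :> 'rV[R]_(n + k).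
Proof.
apply/rowP => j; rewrite !mxE eqxx -[j == _]val_eqE /=.
case: splitP => j' ->; rewrite mxE ?eqxx -?val_eqE /= ?eqn_add2l//.
by rewrite ltn_eqF// (leq_trans (ltn_ord j')) ?leq_addr.
Qed.

Lemma partial_l_lshift n k (F : 'rV[R]_n -> R) (i : 'I_n) :
  partial (lshift k i) (F \o lsubmx) = partial i F \o lsubmx.
Proof.
by apply/funext => x; rewrite /partial derive_lin/= delta_lshift row_mxKl.
Qed.

Lemma partial_l_rshift n k (F : 'rV[R]_n -> R) (i : 'I_k) :
  partial (rshift n i) (F \o lsubmx) = cst 0.
Proof.
apply/funext => x; rewrite /partial derive_lin/= delta_rshift row_mxKl.
by rewrite derive0.
Qed.

Lemma partial_r_lshift n k (F : 'rV[R]_k -> R) (i : 'I_n) :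
  partial (lshift k i) (F \o rsubmx) = cst 0.
Proof.
apply/funext => x; rewrite /partial derive_lin/= delta_lshift row_mxKr.
by rewrite derive0.
Qed.

Lemma partial_r_rshift n k (F : 'rV[R]_k -> R) (i : 'I_k) :
  partial (rshift n i) (F \o rsubmx) = partial i F \o rsubmx.
Proof.
by apply/funext => x; rewrite /partial derive_lin/= delta_rshift row_mxKr.
Qed.

Lemma C_on_l n k r (U : set 'rV[R]_n) (V : set 'rV[R]_(n + k)) F :
  (forall z, V z -> U (lsubmx z)) -> C_on r U F -> C_on r V (F \o lsubmx).
Proof.
move=> VU; elim: r F => [|r IH] F [cF dF]; (split; first
  by move=> z /VU Uz; apply: continuous_comp;
     [exact: continuous_lsubmx|exact: cF]) => //.
move=> i; rewrite -(fintype.splitK i); case: (fintype.split i) => j /=.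
  have [h1 h2] := dF j; split.
    move=> z /VU Uz; apply: derivable_lin.
    by rewrite delta_lshift /= row_mxKl; exact: h1.
  by rewrite partial_l_lshift; exact: IH.
split; last by rewrite partial_l_rshift; exact: C_on_cst.
move=> z Uz; apply: derivable_lin; rewrite delta_rshift /= row_mxKl.
exact: derivable0.
Qed.

Lemma C_on_r n k r (U : set 'rV[R]_k) (V : set 'rV[R]_(n + k)) F :
  (forall z, V z -> U (rsubmx z)) -> C_on r U F -> C_on r V (F \o rsubmx).
Proof.
move=> VU; elim: r F => [|r IH] F [cF dF]; (split; first
  by move=> z /VU Uz; apply: continuous_comp;
     [exact: continuous_rsubmx|exact: cF]) => //.
move=> i; rewrite -(fintype.splitK i); case: (fintype.split i) => j /=.
  split; last by rewrite partial_r_lshift; exact: C_on_cst.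
  move=> z Uz; apply: derivable_lin; rewrite delta_lshift /= row_mxKr.
  exact: derivable0.
have [h1 h2] := dF j; split.
  move=> z /VU Uz; apply: derivable_lin.
  by rewrite delta_rshift /= row_mxKr; exact: h1.
by rewrite partial_r_rshift; exact: IH.
Qed.

End calculus.

(* A smooth n-dimensional manifold without boundary, given by an atlas: each *)
(* chart maps an open set homeomorphically onto an open subset of R^n, with  *)
(* inverse chart_inv (arbitrary off the image of the chart).                 *)
Record manifold (R : realType) (n : nat) := Manifold {
  space :> topologicalType;
  space_nonempty : [set: space] !=set0;
  space_hausdorff : hausdorff_space space;
  space_second_countable : @second_countable space;
  chart : Type;
  dom : chart -> set space;
  coord : chart -> space -> 'rV[R]_n;
  chart_inv : chart -> 'rV[R]_n -> space;
  dom_cover : forall p, exists a, dom a p;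
  dom_open : forall a, open (dom a);
  image_open : forall a, open (coord a @` dom a);
  coordK : forall a p, dom a p -> chart_inv a (coord a p) = p;
  coord_cts : forall a p, dom a p -> {for p, continuous (coord a)};
  chart_inv_cts : forall a x, (coord a @` dom a) x ->
    {for x, continuous (chart_inv a)};
  transition_smooth : forall a b (j : 'I_n),
    smooth_on (coord a @` (dom a `&` dom b))
              (fun x => coord b (chart_inv a x) 0 j) }.

Arguments dom {R n M} : rename.
Arguments coord {R n M} : rename.
Arguments chart_inv {R n M} : rename.
Arguments dom_open {R n M} a : rename.
Arguments image_open {R n M} a : rename.

Section manifold_calculus.
Context {R : realType} {n : nat} {M : manifold R n}.

Definition C_fun (r : nat) (u : M -> R) : Prop :=
  forall a : chart M, C_on r (coord a @` dom a) (u \o chart_inv a).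

Definition smooth_fun (u : M -> R) : Prop := forall r, C_fun r u.

Definition chart_partial (a : chart M) (i : 'I_n) (u : M -> R) (p : M) : R :=
  partial i (u \o chart_inv a) (coord a p).

(* Entry (i, j) is d y_j / d x_i, for x = coord a and y = coord b. *)
Definition transition_jacobian (a b : chart M) (p : M) : 'M[R]_n :=
  \matrix_(i, j) chart_partial a i (fun q => coord b q 0 j) p.

End manifold_calculus.

(* A metric tensor, by its components in each chart; the last axiom is the   *)
(* transformation rule of covariant 2-tensors.                               *)
Record riemannian_metric (R : realType) (n : nat) (M : manifold R n) :=
  RiemannianMetric {
  metric_mx :> chart M -> M -> 'M[R]_n;
  metric_sym : forall a p, dom a p -> (metric_mx a p)^T = metric_mx a p;
  metric_pos : forall a p, dom a p -> forall v : 'rV[R]_n, v != 0 ->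
    0 < (v *m metric_mx a p *m v^T) 0 0;
  metric_smooth : forall a (i j : 'I_n),
    smooth_on (coord a @` dom a) (fun x => metric_mx a (chart_inv a x) i j);
  metric_tensor : forall a b p, dom a p -> dom b p ->
    metric_mx a p =
    transition_jacobian a b p *m metric_mx b p *m (transition_jacobian a b p)^T }.

(* Components in each chart; the transformation rule between charts is not    *)
(* part of the type.                                                         *)
Definition vector_field (R : realType) (n : nat) (M : manifold R n) : Type :=
  chart M -> M -> 'rV[R]_n.

Section operators.
Context {R : realType} {n : nat} {M : manifold R n} (g : riemannian_metric M).

(* (grad u)^i = sum_j g^{ij} d_j u *)
Definition gradient (u : M -> R) : vector_field M :=
  fun a p => \row_i \sum_j invmx (g a p) i j * chart_partial a j u p.

(* div X = (det g)^{-1/2} sum_i d_i ((det g)^{1/2} X^i) in the chart a; for  *)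
(* an X that transforms as a vector field, the value does not depend on a.   *)
Definition divergence (X : vector_field M) (a : chart M) (p : M) : R :=
  (Num.sqrt (\det (g a p)))^-1 *
  \sum_i chart_partial a i (fun q => Num.sqrt (\det (g a q)) * X a q 0 i) p.

Definition laplace_beltrami (u : M -> R) : chart M -> M -> R :=
  divergence (gradient u).

End operators.

Section topology.

Lemma nonempty_setX (T U : Type) :
  [set: T] !=set0 -> [set: U] !=set0 -> [set: T * U] !=set0.
Proof. by move=> [x _] [y _]; exists (x, y). Qed.

Lemma hausdorff_setX (T U : topologicalType) :
  hausdorff_space T -> hausdorff_space U -> hausdorff_space (T * U)%type.
Proof.
move=> hT hU [p p'] [q q'] cl; congr (_, _).
  apply: hT => A B nA nB.
  have [[x y] [/= [Ax _] [Bx _]]] := cl (A `*` setT) (B `*` setT)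
    (ex_intro2 _ _ (A, setT) (conj nA filterT) (@subset_refl _ _))
    (ex_intro2 _ _ (B, setT) (conj nB filterT) (@subset_refl _ _)).
  by exists x.
apply: hU => A B nA nB.
have [[x y] [/= [_ Ay] [_ By]]] := cl (setT `*` A) (setT `*` B)
  (ex_intro2 _ _ (setT, A) (conj filterT nA) (@subset_refl _ _))
  (ex_intro2 _ _ (setT, B) (conj filterT nB) (@subset_refl _ _)).
by exists y.
Qed.

Lemma open_setX (T U : topologicalType) (A : set T) (B : set U) :
  open A -> open B -> open (A `*` B).
Proof.
move=> oA oB; rewrite openE => -[p q] [/= Ap Bq].
exists (A, B) => //; split; exact: open_nbhs_nbhs.
Qed.

Lemma second_countable_setX (T U : topologicalType) :
  @second_countable T -> @second_countable U ->
  @second_countable (T * U)%type.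
Proof.
move=> [BT cT [oT bT]] [BU cU [oU bU]].
exists ((fun AB => AB.1 `*` AB.2) @` (BT `*` BU)).
  exact: sub_countable (card_image_le _ _) (countableX cT cU).
split=> [_ [[A B] [/= BA BB] <-]|].
  by apply: open_setX; [exact: oT|exact: oU].
move=> [p q] O [[A B] [/= nA nB] ABO].
have [A' [BA' A'p] A'A] := bT _ _ nA; have [B' [BB' B'q] B'B] := bU _ _ nB.
exists (A' `*` B'); first by split=> //; exists (A', B').
by move=> [x y] [/= A'x B'y]; apply: ABO; split; [exact: A'A|exact: B'B].
Qed.

Lemma continuous_mx (R : realType) (T : topologicalType) (m n : nat)
    (F : T -> 'M[R]_(m, n)) (x : T) :
  (forall i j, {for x, continuous (fun t => F t i j)}) -> {for x, continuous F}.
Proof.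
move=> cF A [P nP PA]; rewrite /nbhs/=.
have : \forall t \near x, forall ij : 'I_m * 'I_n, P ij.1 ij.2 (F t ij.1 ij.2).
  by apply: filter_forall => -[i j]; exact: cF (nP i j).
by apply: filterS => t Pt; apply: PA => i j; exact: Pt (i, j).
Qed.

End topology.

Section product_manifold.
Context {R : realType} {n k : nat} (M : manifold R n) (N : manifold R k).

Let pspace : topologicalType := (M * N)%type.
Let pdom (c : chart M * chart N) : set pspace := dom c.1 `*` dom c.2.
Let pcoord (c : chart M * chart N) (z : pspace) : 'rV[R]_(n + k) :=
  row_mx (coord c.1 z.1) (coord c.2 z.2).
Let pinv (c : chart M * chart N) (x : 'rV[R]_(n + k)) : pspace :=
  (chart_inv c.1 (lsubmx x), chart_inv c.2 (rsubmx x)).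

Lemma product_imageE c : pcoord c @` pdom c =
  (lsubmx @^-1` (coord c.1 @` dom c.1)) `&`
  (rsubmx @^-1` (coord c.2 @` dom c.2)).
Proof.
apply/seteqP; split=> [_ [[p q] [/= Dp Dq] <-]|x].
  by split; rewrite /pcoord/= ?row_mxKl ?row_mxKr; [exists p|exists q].
move=> [[p Dp px] [q Dq qx]]; exists (p, q) => //.
by rewrite /pcoord /= px qx hsubmxK.
Qed.

Lemma product_cover z : exists c, pdom c z.
Proof.
have [a ha] := dom_cover z.1; have [b hb] := dom_cover z.2.
by exists (a, b).
Qed.

Lemma product_dom_open c : open (pdom c).
Proof. by apply: open_setX; exact: dom_open. Qed.

Lemma product_image_open c : open (pcoord c @` pdom c).
Proof.
rewrite product_imageE; apply: openI.
  by apply: open_comp (image_open c.1) => x _; exact: continuous_lsubmx.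
by apply: open_comp (image_open _) => x _; exact: continuous_rsubmx.
Qed.

Lemma product_coordK c z : pdom c z -> pinv c (pcoord c z) = z.
Proof.
by case: z => p q [/= Dp Dq]; rewrite /pinv/pcoord/= row_mxKl row_mxKr !coordK.
Qed.

Lemma product_coord_cts c z : pdom c z -> {for z, continuous (pcoord c)}.
Proof.
case: z => p q [/= Dp Dq]; apply: continuous_mx => i j.
rewrite -(fintype.splitK j); case: (fintype.split j) => j' /=.
  rewrite (_ : (fun t => _) =
      (fun x : 'rV[R]_n => x i j') \o (coord c.1 \o fst)); last first.
    by apply/funext => t; rewrite /pcoord row_mxEl.
  apply: continuous_comp; last exact: coord_continuous.
  by apply: continuous_comp; [exact: cvg_fst|exact: coord_cts].
rewrite (_ : (fun t => _) =
    (fun x : 'rV[R]_k => x i j') \o (coord c.2 \o snd)); last first.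
  by apply/funext => t; rewrite /pcoord row_mxEr.
apply: continuous_comp; last exact: coord_continuous.
by apply: continuous_comp; [exact: cvg_snd|exact: coord_cts].
Qed.

Lemma product_inv_cts c x : (pcoord c @` pdom c) x ->
  {for x, continuous (pinv c)}.
Proof.
rewrite product_imageE => -[h1 h2]; apply: cvg_pair; first exact: nbhs_filter.
  by apply: continuous_comp; [exact: continuous_lsubmx|exact: chart_inv_cts].
by apply: continuous_comp; [exact: continuous_rsubmx|exact: chart_inv_cts].
Qed.

Lemma product_transition_smooth c d (j : 'I_(n + k)) :
  smooth_on (pcoord c @` (pdom c `&` pdom d))
            (fun x => pcoord d (pinv c x) 0 j).
Proof.
move=> r; rewrite -(fintype.splitK j); case: (fintype.split j) => j' /=.
  rewrite (_ : (fun x => _) =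
      (fun y => coord d.1 (chart_inv c.1 y) 0 j') \o lsubmx); last first.
    by apply/funext => x; rewrite /pcoord row_mxEl.
  apply: C_on_l (@transition_smooth _ _ M c.1 d.1 j' r).
  by move=> _ [[p q] [[/= ? ?] [/= ? ?]] <-]; rewrite row_mxKl; exists p.
rewrite (_ : (fun x => _) =
    (fun y => coord d.2 (chart_inv c.2 y) 0 j') \o rsubmx); last first.
  by apply/funext => x; rewrite /pcoord row_mxEr.
apply: C_on_r (@transition_smooth _ _ N c.2 d.2 j' r).
by move=> _ [[p q] [[/= ? ?] [/= ? ?]] <-]; rewrite row_mxKr; exists q.
Qed.

(* The product atlas, whose charts are the (x, y) |-> (coord a x, coord b y). *)
Definition product_manifold : manifold R (n + k) :=
  @Manifold R (n + k) pspace
    (nonempty_setX (space_nonempty M) (space_nonempty N))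
    (hausdorff_setX (@space_hausdorff _ _ M) (@space_hausdorff _ _ N))
    (second_countable_setX (space_second_countable M)
                           (space_second_countable N))
    (chart M * chart N)%type pdom pcoord pinv
    product_cover product_dom_open product_image_open product_coordK
    product_coord_cts product_inv_cts product_transition_smooth.

Lemma product_jacobian (c d : chart product_manifold)
    (z : product_manifold) : dom c z ->
  transition_jacobian c d z =
  block_mx (transition_jacobian c.1 d.1 z.1) 0
           0 (transition_jacobian c.2 d.2 z.2).
Proof.
move=> _; pose F j' := (fun y => coord d.1 (chart_inv c.1 y) 0 j').
pose G j' := (fun y => coord d.2 (chart_inv c.2 y) 0 j').
have El j' : (fun x => pcoord d (pinv c x) 0 (lshift k j')) = F j' \o lsubmx.
  by apply/funext => x; rewrite /pcoord row_mxEl.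
have Er j' : (fun x => pcoord d (pinv c x) 0 (rshift n j')) = G j' \o rsubmx.
  by apply/funext => x; rewrite /pcoord row_mxEr.
apply/matrixP => i j; rewrite mxE /chart_partial.
rewrite -(fintype.splitK i) -(fintype.splitK j).
case: (fintype.split i) => i'; case: (fintype.split j) => j' /=.
- rewrite block_mxEul mxE (_ : _ \o _ = F j' \o lsubmx); last exact: El.
  by rewrite partial_l_lshift /= row_mxKl.
- rewrite block_mxEur mxE (_ : _ \o _ = G j' \o rsubmx); last exact: Er.
  by rewrite partial_r_lshift.
- rewrite block_mxEdl mxE (_ : _ \o _ = F j' \o lsubmx); last exact: El.
  by rewrite partial_l_rshift.
- rewrite block_mxEdr mxE (_ : _ \o _ = G j' \o rsubmx); last exact: Er.
  by rewrite partial_r_rshift /= row_mxKr.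
Qed.

End product_manifold.

Section warped_product.
Context {R : realType} {n k : nat} {M : manifold R n} {N : manifold R k}.
Variables (f : M -> R) (f_smooth : smooth_fun f) (f_gt0 : forall x, 0 < f x).
Variables (g : riemannian_metric M) (h : riemannian_metric N).

Let P := product_manifold M N.
Let wmx (c : chart P) (z : P) : 'M[R]_(n + k) :=
  block_mx (g c.1 z.1) 0 0 (f z.1 ^+ 2 *: h c.2 z.2).

Lemma warped_sym c z : dom c z -> (wmx c z)^T = wmx c z.
Proof.
by move=> [/= D1 D2]; rewrite tr_block_mx !trmx0 linearZ/= !metric_sym.
Qed.

Lemma warped_pos c z : dom c z -> forall v : 'rV[R]_(n + k), v != 0 ->
  0 < (v *m wmx c z *m v^T) 0 0.
Proof.
move=> [/= D1 D2] v; rewrite -[v]hsubmxK; set v1 := lsubmx v; set v2 := rsubmx v.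
move=> v0; rewrite mul_row_block !mulmx0 add0r addr0 tr_row_mx mul_row_col.
rewrite -scalemxAr -scalemxAl mxE [X in _ + X]mxE.
have f2 : 0 < f z.1 ^+ 2 by rewrite exprn_gt0.
have [v10|v10] := eqVneq v1 0; last first.
  rewrite ltr_wpDr ?metric_pos//.
  have [->|v20] := eqVneq v2 0; first by rewrite !mul0mx mxE mulr0.
  by rewrite mulr_ge0 ?ltW// metric_pos.
have v20 : v2 != 0.
  by apply: contra_neq v0 => v20; rewrite v10 v20 row_mx0.
by rewrite v10 !mul0mx mxE add0r mulr_gt0// metric_pos.
Qed.

Lemma warped_smooth (c : chart P) (i j : 'I_(n + k)) :
  smooth_on (coord c @` dom c) (fun x => wmx c (chart_inv c x) i j).
Proof.
move=> r; have oU := image_open c; set U := coord c @` dom c in oU *.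
have U1 x : U x -> (coord c.1 @` dom c.1) (lsubmx x).
  by move=> [[p q] [/= Dp Dq] <-]; rewrite row_mxKl; exists p.
have U2 x : U x -> (coord c.2 @` dom c.2) (rsubmx x).
  by move=> [[p q] [/= Dp Dq] <-]; rewrite row_mxKr; exists q.
rewrite -(fintype.splitK i) -(fintype.splitK j).
case: (fintype.split i) => i'; case: (fintype.split j) => j' /=.
- rewrite (_ : (fun x => _) =
      (fun y => g c.1 (chart_inv c.1 y) i' j') \o lsubmx); last first.
    by apply/funext => x; rewrite /wmx block_mxEul.
  exact: C_on_l U1 (@metric_smooth _ _ _ g c.1 i' j' r).
- rewrite (_ : (fun x => _) = cst 0); first exact: C_on_cst.
  by apply/funext => x; rewrite /wmx block_mxEur mxE.
- rewrite (_ : (fun x => _) = cst 0); first exact: C_on_cst.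
  by apply/funext => x; rewrite /wmx block_mxEdl mxE.
- have fU := C_on_l U1 (f_smooth r c.1).
  rewrite (_ : (fun x => _) =
      (((f \o chart_inv c.1) \o lsubmx) \* ((f \o chart_inv c.1) \o lsubmx)) \*
      ((fun y => h c.2 (chart_inv c.2 y) i' j') \o rsubmx)); last first.
    by apply/funext => x; rewrite /wmx block_mxEdr mxE expr2.
  apply: C_onM => //; first exact: C_onM.
  exact: C_on_r U2 (@metric_smooth _ _ _ h c.2 i' j' r).
Qed.

Lemma warped_tensor (c d : chart P) z : dom c z -> dom d z ->
  wmx c z = transition_jacobian c d z *m wmx d z *m (transition_jacobian c d z)^T.
Proof.
move=> Dc Dd; rewrite product_jacobian//; case: Dc Dd => C1 C2 [D1 D2].
rewrite tr_block_mx !trmx0 !mulmx_block !(mul0mx, mulmx0, addr0, add0r).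
by rewrite -scalemxAr -scalemxAl /wmx -!metric_tensor.
Qed.

(* g + f^2 h, that is pr_1^* g + (f \o pr_1)^2 pr_2^* h, on M * N *)
Definition warped_metric : riemannian_metric (product_manifold M N) :=
  @RiemannianMetric R (n + k) P wmx
    warped_sym warped_pos warped_smooth warped_tensor.

End warped_product.

Arguments warped_metric {R n k M N} f f_smooth f_gt0 g h.

Lemma C_fun_fst (R : realType) (n k r : nat) (M : manifold R n)
    (N : manifold R k) (u : M -> R) :
  C_fun r u -> @C_fun R (n + k) (product_manifold M N) r (u \o fst).
Proof.
move=> uC c; apply: C_on_l (uC c.1).
by move=> _ [[p q] [/= Dp Dq] <-]; rewrite row_mxKl; exists p.
Qed.

(* Main.v *)
Require Import Defs.
From mathcomp Require Import all_boot all_order all_algebra.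
From mathcomp Require Import all_classical all_reals all_analysis.
Import Order.TTheory GRing.Theory Num.Theory.
Import numFieldNormedType.Exports.
Local Open Scope classical_set_scope.
Local Open Scope ring_scope.

(** The two equations differ by the positive factor [f ^+ k], because of the
    identity
      f^k Delta_gw (u o pi_M) = div_g (f^k grad_g u),
    which is [warped_laplacian] below. It is checked in a product chart, where
    gw is the block diagonal matrix of g and f^2 h.

    - The inverse of gw is block diagonal, so the gradient of u o pi_M is
      (grad_g u, 0): there is no divergence along N
      ([warped_gradient_l], [warped_gradient_r]).
    - det gw = det g * f^(2k) * det h, so the volume density of gw is f^k times
      the product of those of g and h ([warped_volume]). When the flux is
      differentiated along M, the density of h is a constant that cancels
      against the prefactor of the divergence. The factor f^k stays inside the
      derivative and becomes the weight of div_g (f^k grad_g u), while the f^k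
      of the prefactor is moved to the left-hand side.

    The cancellation needs the density of h to be nonzero, which follows from the
    positivity of the determinant of a positive definite matrix
    ([posdef_det_gt0]). In the
    equivalence, going from the product back to M requires a point of N, hence
    N nonempty. *)

(** The segment from the identity to A consists of positive definite, hence
    invertible, matrices. The determinant is a polynomial along it, with value
    1 at the identity, and a sign change would force a root. *)
Lemma posdef_det_gt0 (R : rcfType) (m : nat) (A : 'M[R]_m) :
  (forall v : 'rV[R]_m, v != 0 -> 0 < (v *m A *m v^T) 0 0) -> 0 < \det A.
Proof.
move=> Apos.
(* B is the segment (1 - t) I + t A, as a matrix of polynomials in t. *)
pose B : 'M[{poly R}]_m :=
  \matrix_(i, j) ((1%:M i j)%:P + (A i j - 1%:M i j) *: 'X).
have detB t : (\det B).[t] = \det (1%:M + t *: (A - 1%:M)).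
  rewrite -[LHS]/(horner_eval t (\det B)) -det_map_mx; congr (\det _).
  apply/matrixP => i j; rewrite !mxE /= /horner_eval.
  by rewrite hornerD hornerC hornerZ hornerX mulrC.
have B0 : (\det B).[0] = 1 by rewrite detB scale0r addr0 det1.
have B1 : (\det B).[1] = \det A by rewrite detB scale1r addrC subrK.
rewrite -B1 ltNge; apply/negP => B1le0.
have [|t /andP[t0 t1]] := @poly_ivt _ (- \det B) 0 1 ler01.
  by rewrite !hornerN B0 oppr_le0 oppr_ge0 ler01.
rewrite rootN /root detB => /det0P[v v0 vC].
(* A kernel vector v at time t has (1 - t) |v|^2 + t (v A v^T) = 0. *)
have := congr1 (fun w => (w *m v^T) 0 0) vC.
rewrite mulmxDr mulmx1 -scalemxAr mulmxBr mulmx1 mulmxDl -scalemxAl mulmxBl.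
rewrite mul0mx !mxE; set q := \sum_j _; set r := \sum_j _ => E.
have q_gt0 : 0 < q.
  have [i vi0] : exists i, v 0 i != 0.
    by apply/existsP; apply: contraNT v0; rewrite negb_exists => /forallP h;
       apply/eqP/rowP => i; rewrite mxE; apply/eqP/negPn/h.
  rewrite /q (bigD1 i)//= mxE ltr_wpDr//; last first.
    by rewrite -expr2 exprn_even_gt0.
  by apply: sumr_ge0 => j _; rewrite mxE -expr2 sqr_ge0.
have r_gt0 : 0 < r by have := Apos v v0; rewrite mxE.
have : 0 < q + t * (r - q).
  have -> : q + t * (r - q) = (1 - t) * q + t * r.
    by rewrite mulrBr mulrBl mul1r addrA addrAC.
  have [->|t_neq0] := eqVneq t 0; first by rewrite subr0 mul1r mul0r addr0.
  by rewrite ltr_wpDl ?mulr_ge0 ?mulr_gt0 ?subr_ge0 ?(ltW q_gt0)// lt_def t_neq0.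
by rewrite E ltxx.
Qed.

Lemma metric_det_gt0 (R : realType) (n : nat) (M : manifold R n)
    (g : riemannian_metric M) (a : chart M) (x : M) :
  dom a x -> 0 < \det (g a x).
Proof. by move=> ax; apply: posdef_det_gt0 => v; exact: metric_pos. Qed.

(** For singular A both sides are A, because [invmx] is the identity on singular
    matrices; for the same reason, if D is singular and A is not, the left-hand
    side is A rather than its inverse. *)
Lemma invmx_block_diag_ul (R : comUnitRingType) (m1 m2 : nat)
    (A : 'M[R]_m1) (D : 'M[R]_m2) : D \in unitmx ->
  ulsubmx (invmx (block_mx A 0 0 D)) = invmx A.
Proof.
move=> Du; have [Au|ANu] := boolP (A \in unitmx).
  by rewrite invmx_block_diag ?block_diag_mx_unit ?Au// block_mxKul.
by rewrite !invmx_out ?inE/= ?block_diag_mx_unit ?negb_and ?ANu// block_mxKul.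
Qed.

Lemma invmx_block_diag_dl (R : comUnitRingType) (m1 m2 : nat)
    (A : 'M[R]_m1) (D : 'M[R]_m2) :
  dlsubmx (invmx (block_mx A 0 0 D)) = 0.
Proof.
have [ADu|ADNu] := boolP (block_mx A 0 0 D \in unitmx).
  by rewrite invmx_block_diag// block_mxKdl.
by rewrite invmx_out// block_mxKdl.
Qed.

(** The derivative of F at x along v depends only on the values of F on the line
    through x. Scaling by c != 0 preserves the existence of the limit, and the
    directional derivative is 0 where the limit does not exist, so the equality
    holds in both cases. This compares a function on the product chart with
    one on the chart of M, on a line along M. *)
Lemma derive_homothetic_line (R : realType) (V W : normedModType R)
    (F : V -> R) (G : W -> R) (x v : V) (y w : W) (c : R) : c != 0 ->
  (forall t : R, F (t *: v + x) = c * G (t *: w + y)) ->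
  'D_v F x = c * 'D_w G y.
Proof.
move=> c0 FG; rewrite /derive.
set D := fun t : R => t^-1 *: ((G \o shift y) (t *: w) - G y).
have -> : (fun t => t^-1 *: ((F \o shift x) (t *: v) - F x)) = c *: D.
  apply/funext => t; have := FG 0; rewrite !scale0r !add0r => F0.
  rewrite -[RHS]/(c *: D t) /D /= FG F0 -mulrBr.
  exact: mulrCA.
have [cD|NcD] := pselect (cvg (D t @[t --> 0^'])).
  exact: limZl_tmp.
have -> : lim (D t @[t --> 0^']) = 0 by exact: dvgP.
by rewrite mulr0; apply: dvgP; rewrite is_cvgZlE.
Qed.

Section warped_laplacian.
Context {R : realType} {n k : nat} {M : manifold R n} {N : manifold R k}.
Variables (g : riemannian_metric M) (h : riemannian_metric N).
Variables (f : M -> R) (f_smooth : smooth_fun f) (f_gt0 : forall x, 0 < f x).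
Variables (u : M -> R) (a : chart M) (b : chart N).

Let gw := warped_metric f f_smooth f_gt0 g h.
Let v : product_manifold M N -> R := u \o fst.
Let c : chart (product_manifold M N) := (a, b).

Lemma chart_partial_fst_l (i : 'I_n) z :
  chart_partial c (lshift k i) v z = chart_partial a i u z.1.
Proof.
rewrite /chart_partial -[_ \o _]/((u \o chart_inv a) \o lsubmx).
by rewrite partial_l_lshift/= row_mxKl.
Qed.

Lemma chart_partial_fst_r (i : 'I_k) z :
  chart_partial c (rshift n i) v z = 0.
Proof.
rewrite /chart_partial -[_ \o _]/((u \o chart_inv a) \o lsubmx).
by rewrite partial_l_rshift.
Qed.

Lemma warped_gradient_l (i : 'I_n) (x : M) (y : N) : dom b y ->
  gradient gw v c (x, y) 0 (lshift k i) = gradient g u a x 0 i.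
Proof.
move=> by_; have Du : f x ^+ 2 *: h b y \in unitmx.
  rewrite unitmxE detZ unitfE mulf_neq0 ?expf_neq0 ?gt_eqF//.
  exact: metric_det_gt0.
rewrite !mxE big_split_ord/= [X in _ + X]big1 ?addr0 => [|j _]; last first.
  by rewrite chart_partial_fst_r mulr0.
apply: eq_bigr => j _; rewrite chart_partial_fst_l; congr (_ * _).
by rewrite -(invmx_block_diag_ul _ _ _ (g a x) _ Du) !mxE.
Qed.

(** This holds at every z, even outside the domain of the chart, so that the
    derivatives of this component in the directions of N vanish too. *)
Lemma warped_gradient_r (i : 'I_k) z : gradient gw v c z 0 (rshift n i) = 0.
Proof.
rewrite !mxE big_split_ord/= !big1 ?addr0// => j _.
  by rewrite chart_partial_fst_r mulr0.
have /matrixP/(_ i j) :=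
  invmx_block_diag_dl _ _ _ (g a z.1) (f z.1 ^+ 2 *: h b z.2).
by rewrite !mxE => ->; rewrite mul0r.
Qed.

(** The square root is split with [0 <= \det (h b y)] alone, so that the formula
    holds for all x and can be differentiated in x at a fixed y. *)
Lemma warped_volume (x : M) (y : N) : dom b y ->
  Num.sqrt (\det (gw c (x, y))) =
  Num.sqrt (\det (h b y)) * (f x ^+ k * Num.sqrt (\det (g a x))).
Proof.
move=> by_; have h0 := ltW (metric_det_gt0 _ _ _ h _ _ by_).
have fk0 : 0 <= f x ^+ k by rewrite exprn_ge0// ltW.
rewrite det_ublock detZ mulrC -mulrA exprAC sqrtrM ?sqr_ge0//.
by rewrite sqrtr_sqr ger0_norm// sqrtrM// mulrCA.
Qed.

(** The density of h at y is constant in x, so it leaves the derivatives along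
    M and cancels. *)
Lemma warped_laplacian (x : M) (y : N) : dom b y ->
  f x ^+ k * laplace_beltrami gw v c (x, y) =
  divergence g (fun a x => f x ^+ k *: gradient g u a x) a x.
Proof.
move=> by_; set X := (fun _ _ => _).
have sh0 : Num.sqrt (\det (h b y)) != 0.
  by rewrite gt_eqF// sqrtr_gt0 metric_det_gt0.
rewrite /laplace_beltrami /divergence warped_volume// big_split_ord/=.
rewrite [X in _ * (_ + X)]big1 ?addr0 => [|i _]; last first.
  rewrite /chart_partial /partial (_ : _ \o _ = cst 0) ?derive_cst//.
  by apply/funext => q /=; rewrite warped_gradient_r mulr0.
rewrite (eq_bigr (fun i => Num.sqrt (\det (h b y)) * chart_partial a i
    (fun q => Num.sqrt (\det (g a q)) * X a q 0 i) x)) => [|i _].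
  rewrite -mulr_sumr !invfM mulrACA mulVf// mul1r -mulrA.
  by rewrite mulVKf// gt_eqF ?exprn_gt0.
apply: derive_homothetic_line sh0 _ => t.
(* A line along M keeps the N-component of the point at [coord b y]. *)
rewrite delta_lshift scale_row_mx scaler0 add_row_mx add0r /=.
rewrite row_mxKl row_mxKr coordK// warped_volume// warped_gradient_l//.
rewrite /X [in RHS]mxE.
by rewrite -!mulrA; congr (_ * _); rewrite mulrCA.
Qed.

End warped_laplacian.

Theorem proposition1p2 (R : realType) (n k : nat)
    (M : manifold R n) (N : manifold R k)
    (g : riemannian_metric M) (h : riemannian_metric N)
    (M_compact : compact [set: M]) (N_compact : compact [set: N])
    (f : M -> R) (f_smooth : smooth_fun f) (f_gt0 : forall x : M, 0 < f x)
    (p eps : R) (p_gt2 : 2 < p) (eps_gt0 : 0 < eps)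
    (u : M -> R) (u_gt0 : forall x : M, 0 < u x) (u_C2 : C_fun 2 u) :
  let fk_grad_u : vector_field M := fun a x => f x ^+ k *: gradient g u a x in
  let gw := warped_metric f f_smooth f_gt0 g h in
  let v : product_manifold M N -> R := u \o fst in
  (forall (a : chart M) (x : M), dom a x ->
     - eps ^+ 2 * divergence g fk_grad_u a x + f x ^+ k * u x
       = f x ^+ k * u x `^ (p - 1))
  <->
  (forall (c : chart (product_manifold M N)) (z : product_manifold M N),
     dom c z ->
     - eps ^+ 2 * laplace_beltrami gw v c z + v z = v z `^ (p - 1)).
Proof.
move=> fk_grad_u gw v.
have fk0 x : f x ^+ k != 0 by rewrite gt_eqF ?exprn_gt0.
have lap a b x y : dom b y ->
    - eps ^+ 2 * divergence g fk_grad_u a x + f x ^+ k * u x =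
    f x ^+ k * (- eps ^+ 2 * laplace_beltrami gw v (a, b) (x, y) + v (x, y)).
  move=> by_; rewrite -(warped_laplacian g h _ f_smooth f_gt0 u _ b _ y)//.
  by rewrite mulrDr mulrCA.
split=> [eqM [a b] [x y] [/= ax by_]|eqP a x ax].
  by apply: (mulfI (fk0 x)); rewrite -(lap a b)// eqM.
have [y _] := space_nonempty N; have [b by_] := dom_cover y.
by rewrite (lap a b x y)// (eqP (a, b) (x, y)).
Qed.
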